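(* Let $(A,\{\!\!\{-,-\}\!\!\})$ be a (non-graded, not necessarily unital) double Poisson algebra over a commutative ring $\mathbb{K}$ and let $v$ be a cyclic bilinear form on a coalgebra $M$ over $\mathbb{K}$. Then there is a unique Poisson bracket $\{-,-\}_v$ in the representation algebra $A_M$ such that for any $a,b\in A$, $\alpha,\beta\in M$, and any finite expansions $$\{\!\!\{a,b\}\!\!\}=\sum_i a_i\otimes b_i\in A\otimes A,\qquad \widehat v(\alpha\otimes\beta)=\sum_j \alpha_j\otimes\beta_j\in M\otimes M,$$ we have $$\{a_\alpha,b_\beta\}_v=\sum_{i,j}(a_i)_{\alpha_j}(b_i)_{\beta_j}\in A_M.$$
   Context: All modules, algebras, coalgebras and tensor products are over a fixed commutative ring $\mathbb{K}$. Algebras are associative but not necessarily unital; coalgebras are coassociative but not necessarily counital. For a coalgebra $M$ with comultiplication $\mu$, write $\mu(\alpha)=\alpha^1\otimes\alpha^2$ and, for iterated comultiplication with values in $M^{\otimes m}$, $\alpha^1\otimes\cdots\otimes\alpha^m$ (summation suppressed). Representation algebra: $A_M$ is the commutative (non-unital) algebra generated by symbols $a_\alpha$ ($a\in A$, $\alpha\in M$) subject to: $a_\alpha$ is $\mathbb{K}$-bilinear in $(a,\alpha)$; $(ab)_\alpha=a_{\alpha^1}b_{\alpha^2}$ (summation suppressed); and all generators commute. Double Poisson algebra: an algebra $A$ with a linear map $\{\!\!\{-,-\}\!\!\}:A\otimes A\to A\otimes A$ (write $\{\!\!\{a,b\}\!\!\}$ for the image of $a\otimes b$) such that, with $P_{21}(x\otimes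 y)=y\otimes x$: (1) $\{\!\!\{b,a\}\!\!\}=-P_{21}\{\!\!\{a,b\}\!\!\}$; (2) $\{\!\!\{a,bc\}\!\!\}=\{\!\!\{a,b\}\!\!\}c+b\{\!\!\{a,c\}\!\!\}$, where $a(x\otimes y)b=ax\otimes yb$; (3) $\{\!\!\{ab,c\}\!\!\}=a*\{\!\!\{b,c\}\!\!\}+\{\!\!\{a,c\}\!\!\}*b$, where $a*(x\otimes y)*b=xb\otimes ay$ (with one-sided versions $a*(x\otimes y)=x\otimes ay$, $(x\otimes y)*b=xb\otimes y$); (4) the induced tribracket $\sum_{i=0}^2P_{312}^i(\{\!\!\{-,-\}\!\!\}\otimes \mathrm{id}_A)(\mathrm{id}_A\otimes\{\!\!\{-,-\}\!\!\})P_{312}^{-i}$ on $A^{\otimes3}$ is zero, where $P_{312}(a_1\otimes a_2\otimes a_3)=a_3\otimes a_1\otimes a_2$. Cyclic form: a bilinear form $v:M\otimes M\to\mathbb{K}$ determines a linear map $\widehat v:M\otimes M\to M\otimes M$, $\widehat v(\alpha\otimes\beta)=v(\alpha\otimes\beta^2)\,\beta^1\otimes\beta^3$. The form $v$ is cyclic if $\widehat v$ commutes with the flip $\alpha\otimes\beta\mapsto\beta\otimes\alpha$ of $M\otimes M$. A Poisson bracket in a commutative algebra is a bilinear bracket $\{-,-\}$ with $\{x,y\}=-\{y,x\}$ that satisfies the Leibniz rule in each variable and the Jacobi identity. *)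

(* Defs.v *)
From HB Require Import structures.
From mathcomp Require Import all_boot all_algebra.
From mathcomp Require Import boolp.

Set Implicit Arguments.
Unset Strict Implicit.
Unset Printing Implicit Defensive.

Import GRing.Theory.
Local Open Scope ring_scope.
Local Open Scope quotient_scope.

Reserved Notation "x ⊗ y" (at level 40, left associativity).
Reserved Notation "x ∙ y" (at level 40, left associativity).

(* sesquilinear.v has bilinear maps over nonzero rings only; here the base     *)
(* ring is an arbitrary commutative ring.                                      *)
Definition bilin (K : comPzRingType) (U V W : lmodType K) (f : U -> V -> W) :=
  (forall v, linear (f^~ v)) /\ (forall u, linear (f u)).

Inductive lterm (K G : Type) :=
  | LGen of G
  | LZero
  | LAdd of lterm K G & lterm K G
  | LOpp of lterm K G
  | LScale of K & lterm K G.
Arguments LGen {K G}.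
Arguments LZero {K G}.

HB.instance Definition _ K G := gen_eqMixin (lterm K G).
HB.instance Definition _ K G := gen_choiceMixin (lterm K G).

Section ModulePresentation.
Variables (K : comPzRingType) (G : Type).
Implicit Types (x y z : lterm K G) (R : lterm K G -> lterm K G -> Prop).

(* The least congruence that contains R and makes the quotient a K-module. *)
Inductive lcong R : lterm K G -> lterm K G -> Prop :=
  | LcRel x y : R x y -> lcong R x y
  | LcRefl x : lcong R x x
  | LcSym x y : lcong R x y -> lcong R y x
  | LcTrans y x z : lcong R x y -> lcong R y z -> lcong R x z
  | LcAdd x x' y y' :
      lcong R x x' -> lcong R y y' -> lcong R (LAdd x y) (LAdd x' y')
  | LcOpp x x' : lcong R x x' -> lcong R (LOpp x) (LOpp x')
  | LcScale k x x' : lcong R x x' -> lcong R (LScale k x) (LScale k x')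
  | LcAddA x y z : lcong R (LAdd x (LAdd y z)) (LAdd (LAdd x y) z)
  | LcAddC x y : lcong R (LAdd x y) (LAdd y x)
  | LcAdd0 x : lcong R (LAdd LZero x) x
  | LcAddN x : lcong R (LAdd (LOpp x) x) LZero
  | LcScaleA k l x : lcong R (LScale k (LScale l x)) (LScale (k * l) x)
  | LcScale1 x : lcong R (LScale 1 x) x
  | LcScaleDr k x y :
      lcong R (LScale k (LAdd x y)) (LAdd (LScale k x) (LScale k y))
  | LcScaleDl k l x :
      lcong R (LScale (k + l) x) (LAdd (LScale k x) (LScale l x)).

Variable R : lterm K G -> lterm K G -> Prop.

Definition lcongb : rel (lterm K G) := fun x y => `[< lcong R x y >].

Lemma lcongb_equiv : equiv_class_of lcongb.
Proof.
split=> [x|x y|y x z]; rewrite /lcongb.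
- by apply/asboolP; exact: LcRefl.
- by apply/asboolP/asboolP; exact: LcSym.
- by move=> /asboolP xy /asboolP yz; apply/asboolP; exact: LcTrans xy yz.
Qed.

Canonical lcong_equiv := EquivRelPack lcongb_equiv.

Definition lpres := {eq_quot lcong_equiv}.
HB.instance Definition _ := Choice.on lpres.

Definition lclass (x : lterm K G) : lpres := \pi_({eq_quot lcong_equiv}) x.
Definition lrepr (u : lpres) : lterm K G := repr (u : {eq_quot lcong_equiv}).

Lemma lreprK u : lclass (lrepr u) = u.
Proof. exact: (@reprK _ {eq_quot lcong_equiv}). Qed.

Lemma lclassP x y : lclass x = lclass y <-> lcong R x y.
Proof.
split=> [/(@eqquotP _ _ {eq_quot lcong_equiv})/asboolP //|xy].
by apply/(@eqquotP _ _ {eq_quot lcong_equiv})/asboolP.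
Qed.

Lemma lrepr_class x : lcong R (lrepr (lclass x)) x.
Proof. by apply/lclassP; rewrite lreprK. Qed.

Lemma lpresW (P : lpres -> Prop) : (forall x, P (lclass x)) -> forall u, P u.
Proof. by move=> Pc u; rewrite -(lreprK u). Qed.

Definition lzero := lclass LZero.
Definition ladd u w := lclass (LAdd (lrepr u) (lrepr w)).
Definition lopp u := lclass (LOpp (lrepr u)).
Definition lscale k u := lclass (LScale k (lrepr u)).

Lemma laddE x y : ladd (lclass x) (lclass y) = lclass (LAdd x y).
Proof. by apply/lclassP; apply: LcAdd; exact: lrepr_class. Qed.
Lemma loppE x : lopp (lclass x) = lclass (LOpp x).
Proof. by apply/lclassP; apply: LcOpp; exact: lrepr_class. Qed.
Lemma lscaleE k x : lscale k (lclass x) = lclass (LScale k x).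
Proof. by apply/lclassP; apply: LcScale; exact: lrepr_class. Qed.

Fact laddA : associative ladd.
Proof.
elim/lpresW=> x; elim/lpresW=> y; elim/lpresW=> z; rewrite !laddE.
by apply/lclassP; exact: LcAddA.
Qed.
Fact laddC : commutative ladd.
Proof.
by elim/lpresW=> x; elim/lpresW=> y; rewrite !laddE; apply/lclassP; exact: LcAddC.
Qed.
Fact ladd0 : left_id lzero ladd.
Proof. by elim/lpresW=> x; rewrite laddE; apply/lclassP; exact: LcAdd0. Qed.
Fact laddN : left_inverse lzero lopp ladd.
Proof.
by elim/lpresW=> x; rewrite loppE laddE; apply/lclassP; exact: LcAddN.
Qed.
HB.instance Definition _ := GRing.isZmodule.Build lpres laddA laddC ladd0 laddN.

Fact lscaleA k l u : lscale k (lscale l u) = lscale (k * l) u.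
Proof.
by elim/lpresW: u => x; rewrite !lscaleE; apply/lclassP; exact: LcScaleA.
Qed.
Fact lscale1 : left_id 1 lscale.
Proof. by elim/lpresW=> x; rewrite lscaleE; apply/lclassP; exact: LcScale1. Qed.
Fact lscaleDr : right_distributive lscale +%R.
Proof.
move=> k; elim/lpresW=> x; elim/lpresW=> y; rewrite /+%R /= laddE !lscaleE laddE.
by apply/lclassP; exact: LcScaleDr.
Qed.
Fact lscaleDl u : {morph lscale^~ u : k l / k + l}.
Proof.
move=> k l; elim/lpresW: u => x; rewrite [in RHS]/+%R /= !lscaleE laddE.
by apply/lclassP; exact: LcScaleDl.
Qed.
HB.instance Definition _ :=
  GRing.Zmodule_isLmodule.Build K lpres lscaleA lscale1 lscaleDr lscaleDl.

Lemma lclass0 : lclass LZero = 0.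
Proof. by []. Qed.
Lemma lclassD x y : lclass (LAdd x y) = lclass x + lclass y.
Proof. by rewrite -laddE. Qed.
Lemma lclassN x : lclass (LOpp x) = - lclass x.
Proof. by rewrite -loppE. Qed.
Lemma lclassZ k x : lclass (LScale k x) = k *: lclass x.
Proof. by rewrite -lscaleE. Qed.

Section Eval.
Variables (W : lmodType K) (f : G -> W).

Fixpoint leval (x : lterm K G) : W :=
  match x with
  | LGen g => f g
  | LZero => 0
  | LAdd x y => leval x + leval y
  | LOpp x => - leval x
  | LScale k x => k *: leval x
  end.

Hypothesis fR : forall x y, R x y -> leval x = leval y.

Lemma leval_cong x y : lcong R x y -> leval x = leval y.
Proof.
elim=> //=.
- by move=> {}x {}y z _ -> _ ->.
- by move=> {}x x' {}y y' _ -> _ ->.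
- by move=> {}x x' _ ->.
- by move=> k {}x x' _ ->.
- by move=> *; rewrite addrA.
- by move=> *; rewrite addrC.
- by move=> *; rewrite add0r.
- by move=> *; rewrite addNr.
- by move=> *; rewrite scalerA.
- by move=> *; rewrite scale1r.
- by move=> *; rewrite scalerDr.
- by move=> *; rewrite scalerDl.
Qed.
End Eval.
End ModulePresentation.

Section Tensor.
Variables (K : comPzRingType) (U V : lmodType K).

Inductive tensor_rel : lterm K (U * V) -> lterm K (U * V) -> Prop :=
  | TensorDl u u' v : tensor_rel (LGen (u + u', v)) (LAdd (LGen (u, v)) (LGen (u', v)))
  | TensorDr u v v' : tensor_rel (LGen (u, v + v')) (LAdd (LGen (u, v)) (LGen (u, v')))
  | TensorZl k u v : tensor_rel (LGen (k *: u, v)) (LScale k (LGen (u, v)))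
  | TensorZr k u v : tensor_rel (LGen (u, k *: v)) (LScale k (LGen (u, v))).

Definition tensor := lpres tensor_rel.
HB.instance Definition _ := GRing.Lmodule.on tensor.

Definition tpure (u : U) (v : V) : tensor := lclass tensor_rel (LGen (u, v)).

Lemma tpure_bilin : bilin tpure.
Proof.
split=> [v k u u'|u k v v']; rewrite /tpure.
- have -> : lclass tensor_rel (LGen (k *: u + u', v)) =
            lclass tensor_rel (LAdd (LScale k (LGen (u, v))) (LGen (u', v))).
    apply/lclassP; apply: (@LcTrans _ _ _ (LAdd (LGen (k *: u, v)) (LGen (u', v)))).
      exact/LcRel/TensorDl.
    by apply: LcAdd; [exact/LcRel/TensorZl | exact: LcRefl].
  by rewrite lclassD lclassZ.
- have -> : lclass tensor_rel (LGen (u, k *: v + v')) =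
            lclass tensor_rel (LAdd (LScale k (LGen (u, v))) (LGen (u, v'))).
    apply/lclassP; apply: (@LcTrans _ _ _ (LAdd (LGen (u, k *: v)) (LGen (u, v')))).
      exact/LcRel/TensorDr.
    by apply: LcAdd; [exact/LcRel/TensorZr | exact: LcRefl].
  by rewrite lclassD lclassZ.
Qed.

HB.instance Definition _ u :=
  GRing.isLinear.Build K V tensor _ (tpure u) (tpure_bilin.2 u).
Definition tpurer v u := tpure u v.
HB.instance Definition _ v :=
  GRing.isLinear.Build K U tensor _ (tpurer v) (tpure_bilin.1 v).

Lemma tensor_expand (t : tensor) :
  exists s : seq (U * V), t = \sum_(p <- s) tpure p.1 p.2.
Proof.
elim/lpresW: t; elim=> [[u v]||x [s xE] y [s' yE]|x [s xE]|k x [s xE]].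
- by exists [:: (u, v)]; rewrite big_seq1.
- by exists [::]; rewrite big_nil.
- by exists (s ++ s'); rewrite big_cat -xE -yE lclassD.
- exists [seq (- p.1, p.2) | p <- s]; rewrite lclassN xE big_map -sumrN.
  by apply: eq_bigr => p _; rewrite -(raddfN (tpurer p.2)).
- exists [seq (k *: p.1, p.2) | p <- s]; rewrite lclassZ xE big_map scaler_sumr.
  by apply: eq_bigr => p _; rewrite -(linearZ_LR (tpurer p.2)).
Qed.

Section Lift.
Variables (W : lmodType K) (f : U -> V -> W).

Definition tlift of bilin f := fun t : tensor => leval (fun p => f p.1 p.2) (lrepr t).

Hypothesis fb : bilin f.

Lemma tlift_class x : tlift fb (lclass tensor_rel x) = leval (fun p => f p.1 p.2) x.
Proof.
rewrite /tlift; apply: leval_cong (lrepr_class _ _) => {}x _ [] /=.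
- by move=> u u' v; have := fb.1 v 1 u u'; rewrite !scale1r.
- by move=> u v v'; have := fb.2 u 1 v v'; rewrite !scale1r.
- move=> k u v; have f0 : f 0 v = 0.
    by apply: (@addrI _ (f 0 v)); rewrite addr0 -{1}[f 0 v]scale1r -fb.1 scaler0 add0r.
  by have := fb.1 v k u 0; rewrite f0 !addr0.
- move=> k u v; have f0 : f u 0 = 0.
    by apply: (@addrI _ (f u 0)); rewrite addr0 -{1}[f u 0]scale1r -fb.2 scaler0 add0r.
  by have := fb.2 u k v 0; rewrite f0 !addr0.
Qed.

Lemma tlift_linear : linear (tlift fb).
Proof.
move=> k; elim/lpresW=> x; elim/lpresW=> y.
by rewrite -lclassZ -lclassD !tlift_class.
Qed.
HB.instance Definition _ := GRing.isLinear.Build K tensor W _ (tlift fb) tlift_linear.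

Lemma tliftE u v : tlift fb (tpure u v) = f u v.
Proof. by rewrite tlift_class. Qed.
End Lift.

Lemma tensor_ext (W : lmodType K) (f g : {linear tensor -> W}) :
  (forall u v, f (tpure u v) = g (tpure u v)) -> f =1 g.
Proof.
move=> fg t; have [s ->] := tensor_expand t.
by rewrite !linear_sum; apply: eq_bigr.
Qed.
End Tensor.
Arguments tensor {K} (U V)%_type.

Notation "U ⊗ V" := (tensor U V) : type_scope.
Notation "u ⊗ v" := (tpure u v) : ring_scope.

Section TensorMaps.
Variable K : comPzRingType.
Implicit Types U V W : lmodType K.

Lemma linear_bilin_l U V W W' (f : U -> V -> W) (g : {linear W -> W'}) :
  bilin f -> bilin (fun u v => g (f u v)).
Proof.
by move=> [fl fr]; split=> [v|u] k x y /=; rewrite (fl, fr) linearP.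
Qed.

Lemma tmap_bilin U U' V V' (f : {linear U -> U'}) (g : {linear V -> V'}) :
  bilin (fun u v => f u ⊗ g v).
Proof.
by split=> [v|u] k x y; rewrite linearP ((tpure_bilin _ _).1, (tpure_bilin _ _).2).
Qed.
Definition tmap U U' V V' (f : {linear U -> U'}) (g : {linear V -> V'}) :
  U ⊗ V -> U' ⊗ V' := tlift (tmap_bilin f g).
HB.instance Definition _ U U' V V' (f : {linear U -> U'}) (g : {linear V -> V'}) :=
  GRing.Linear.on (tmap f g).
Lemma tmapE U U' V V' (f : {linear U -> U'}) (g : {linear V -> V'}) u v :
  tmap f g (u ⊗ v) = f u ⊗ g v.
Proof. exact: tliftE. Qed.

Lemma tswap_bilin U V : bilin (fun (u : U) (v : V) => v ⊗ u).
Proof. by split=> [v|u]; [exact: (tpure_bilin _ _).2 | exact: (tpure_bilin _ _).1]. Qed.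
Definition tswap U V : U ⊗ V -> V ⊗ U := tlift (tswap_bilin U V).
HB.instance Definition _ U V := GRing.Linear.on (@tswap U V).
Lemma tswapE U V (u : U) (v : V) : tswap (u ⊗ v) = v ⊗ u.
Proof. exact: tliftE. Qed.

Lemma tassoc_bilin U V W :
  bilin (fun (t : U ⊗ V) (w : W) => tmap idfun (tpurer w) t : U ⊗ (V ⊗ W)).
Proof.
split=> [w|t] k x y; first by rewrite linearP.
have [s ->] := tensor_expand t; rewrite !linear_sum -big_split.
by apply: eq_bigr => p _ /=; rewrite !tmapE /= /tpurer !linearP.
Qed.
Definition tassoc U V W : (U ⊗ V) ⊗ W -> U ⊗ (V ⊗ W) := tlift (tassoc_bilin U V W).
HB.instance Definition _ U V W := GRing.Linear.on (@tassoc U V W).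
Lemma tassocE U V W (u : U) (v : V) (w : W) : tassoc ((u ⊗ v) ⊗ w) = u ⊗ (v ⊗ w).
Proof. by rewrite /tassoc tliftE tmapE. Qed.

Lemma tassocV_bilin U V W :
  bilin (fun (u : U) (t : V ⊗ W) => tmap (tpure u) idfun t : (U ⊗ V) ⊗ W).
Proof.
split=> [t|u] k x y; last by rewrite linearP.
have [s ->] := tensor_expand t; rewrite !linear_sum -big_split.
apply: eq_bigr => p _ /=; rewrite !tmapE /=.
by rewrite (tpure_bilin _ _).1 (tpure_bilin _ _).1.
Qed.
Definition tassocV U V W : U ⊗ (V ⊗ W) -> (U ⊗ V) ⊗ W := tlift (tassocV_bilin U V W).
HB.instance Definition _ U V W := GRing.Linear.on (@tassocV U V W).
Lemma tassocVE U V W (u : U) (v : V) (w : W) : tassocV (u ⊗ (v ⊗ w)) = (u ⊗ v) ⊗ w.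
Proof. by rewrite /tassocV tliftE tmapE. Qed.

Lemma tassocK U V W : cancel (@tassoc U V W) (@tassocV U V W).
Proof.
move=> t; have [s ->] := tensor_expand t; rewrite !linear_sum.
apply: eq_bigr => -[r w] _ /=; have [s' ->] := tensor_expand r.
rewrite -/(tpurer w _) (linear_sum (tpurer w)) !linear_sum /=.
by apply: eq_bigr => p _; rewrite tassocE tassocVE.
Qed.

Lemma tassocVK U V W : cancel (@tassocV U V W) (@tassoc U V W).
Proof.
move=> t; have [s ->] := tensor_expand t; rewrite !linear_sum.
apply: eq_bigr => -[u r] _ /=; have [s' ->] := tensor_expand r.
by rewrite !linear_sum; apply: eq_bigr => p _ /=; rewrite tassocVE tassocE.
Qed.
End TensorMaps.

HB.mixin Record Lmodule_isNUAlgebra (K : comPzRingType) A of GRing.Lmodule K A := {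
  nmul : A -> A -> A;
  nmulA : associative nmul;
  nmul_bilin : bilin nmul
}.
#[short(type="nuAlgType")]
HB.structure Definition NUAlgebra (K : comPzRingType) :=
  {A of Lmodule_isNUAlgebra K A & GRing.Lmodule K A}.
Notation "a ∙ b" := (nmul a b) : ring_scope.

HB.mixin Record NUAlgebra_isComm (K : comPzRingType) A of NUAlgebra K A := {
  nmulC : commutative (@nmul K A)
}.
#[short(type="comNuAlgType")]
HB.structure Definition ComNUAlgebra (K : comPzRingType) :=
  {A of NUAlgebra_isComm K A & NUAlgebra K A}.

HB.mixin Record Lmodule_isCoalgebra (K : comPzRingType) M of GRing.Lmodule K M := {
  comul : {linear M -> (M ⊗ M)%type};
  comulA : forall x,
    tassoc (tmap comul (idfun : {linear M -> M}) (comul x)) =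
    tmap (idfun : {linear M -> M}) comul (comul x)
}.
#[short(type="coalgType")]
HB.structure Definition Coalgebra (K : comPzRingType) :=
  {M of Lmodule_isCoalgebra K M & GRing.Lmodule K M}.

Inductive aterm (K G : Type) :=
  | AGen of G
  | AZero
  | AAdd of aterm K G & aterm K G
  | AOpp of aterm K G
  | AScale of K & aterm K G
  | AMul of aterm K G & aterm K G.
Arguments AGen {K G}.
Arguments AZero {K G}.

HB.instance Definition _ K G := gen_eqMixin (aterm K G).
HB.instance Definition _ K G := gen_choiceMixin (aterm K G).

Section AlgebraPresentation.
Variables (K : comPzRingType) (G : Type).
Implicit Types (x y z : aterm K G) (R : aterm K G -> aterm K G -> Prop).

(* The least congruence that contains R and makes the quotient a commutative *)
(* (associative, non-unital) K-algebra.                                      *)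
Inductive acong R : aterm K G -> aterm K G -> Prop :=
  | AcRel x y : R x y -> acong R x y
  | AcRefl x : acong R x x
  | AcSym x y : acong R x y -> acong R y x
  | AcTrans y x z : acong R x y -> acong R y z -> acong R x z
  | AcAdd x x' y y' :
      acong R x x' -> acong R y y' -> acong R (AAdd x y) (AAdd x' y')
  | AcOpp x x' : acong R x x' -> acong R (AOpp x) (AOpp x')
  | AcScale k x x' : acong R x x' -> acong R (AScale k x) (AScale k x')
  | AcMul x x' y y' :
      acong R x x' -> acong R y y' -> acong R (AMul x y) (AMul x' y')
  | AcAddA x y z : acong R (AAdd x (AAdd y z)) (AAdd (AAdd x y) z)
  | AcAddC x y : acong R (AAdd x y) (AAdd y x)
  | AcAdd0 x : acong R (AAdd AZero x) x
  | AcAddN x : acong R (AAdd (AOpp x) x) AZero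
  | AcScaleA k l x : acong R (AScale k (AScale l x)) (AScale (k * l) x)
  | AcScale1 x : acong R (AScale 1 x) x
  | AcScaleDr k x y :
      acong R (AScale k (AAdd x y)) (AAdd (AScale k x) (AScale k y))
  | AcScaleDl k l x :
      acong R (AScale (k + l) x) (AAdd (AScale k x) (AScale l x))
  | AcMulA x y z : acong R (AMul x (AMul y z)) (AMul (AMul x y) z)
  | AcMulC x y : acong R (AMul x y) (AMul y x)
  | AcMulDl x y z : acong R (AMul (AAdd x y) z) (AAdd (AMul x z) (AMul y z))
  | AcMulZl k x y : acong R (AMul (AScale k x) y) (AScale k (AMul x y)).

Variable R : aterm K G -> aterm K G -> Prop.

Definition acongb : rel (aterm K G) := fun x y => `[< acong R x y >].

Lemma acongb_equiv : equiv_class_of acongb.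
Proof.
split=> [x|x y|y x z]; rewrite /acongb.
- by apply/asboolP; exact: AcRefl.
- by apply/asboolP/asboolP; exact: AcSym.
- by move=> /asboolP xy /asboolP yz; apply/asboolP; exact: AcTrans xy yz.
Qed.

Canonical acong_equiv := EquivRelPack acongb_equiv.

Definition apres := {eq_quot acong_equiv}.
HB.instance Definition _ := Choice.on apres.

Definition aclass (x : aterm K G) : apres := \pi_({eq_quot acong_equiv}) x.
Definition arepr (u : apres) : aterm K G := repr (u : {eq_quot acong_equiv}).

Lemma areprK u : aclass (arepr u) = u.
Proof. exact: (@reprK _ {eq_quot acong_equiv}). Qed.

Lemma aclassP x y : aclass x = aclass y <-> acong R x y.
Proof.
split=> [/(@eqquotP _ _ {eq_quot acong_equiv})/asboolP //|xy].
by apply/(@eqquotP _ _ {eq_quot acong_equiv})/asboolP.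
Qed.

Lemma arepr_class x : acong R (arepr (aclass x)) x.
Proof. by apply/aclassP; rewrite areprK. Qed.

Lemma apresW (P : apres -> Prop) : (forall x, P (aclass x)) -> forall u, P u.
Proof. by move=> Pc u; rewrite -(areprK u). Qed.

Definition azero := aclass AZero.
Definition aadd u w := aclass (AAdd (arepr u) (arepr w)).
Definition aopp u := aclass (AOpp (arepr u)).
Definition ascale k u := aclass (AScale k (arepr u)).
Definition amul u w := aclass (AMul (arepr u) (arepr w)).

Lemma aaddE x y : aadd (aclass x) (aclass y) = aclass (AAdd x y).
Proof. by apply/aclassP; apply: AcAdd; exact: arepr_class. Qed.
Lemma aoppE x : aopp (aclass x) = aclass (AOpp x).
Proof. by apply/aclassP; apply: AcOpp; exact: arepr_class. Qed.
Lemma ascaleE k x : ascale k (aclass x) = aclass (AScale k x).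
Proof. by apply/aclassP; apply: AcScale; exact: arepr_class. Qed.
Lemma amulE x y : amul (aclass x) (aclass y) = aclass (AMul x y).
Proof. by apply/aclassP; apply: AcMul; exact: arepr_class. Qed.

Fact aaddA : associative aadd.
Proof.
elim/apresW=> x; elim/apresW=> y; elim/apresW=> z; rewrite !aaddE.
by apply/aclassP; exact: AcAddA.
Qed.
Fact aaddC : commutative aadd.
Proof.
by elim/apresW=> x; elim/apresW=> y; rewrite !aaddE; apply/aclassP; exact: AcAddC.
Qed.
Fact aadd0 : left_id azero aadd.
Proof. by elim/apresW=> x; rewrite aaddE; apply/aclassP; exact: AcAdd0. Qed.
Fact aaddN : left_inverse azero aopp aadd.
Proof.
by elim/apresW=> x; rewrite aoppE aaddE; apply/aclassP; exact: AcAddN.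
Qed.
HB.instance Definition _ := GRing.isZmodule.Build apres aaddA aaddC aadd0 aaddN.

Fact ascaleA k l u : ascale k (ascale l u) = ascale (k * l) u.
Proof.
by elim/apresW: u => x; rewrite !ascaleE; apply/aclassP; exact: AcScaleA.
Qed.
Fact ascale1 : left_id 1 ascale.
Proof. by elim/apresW=> x; rewrite ascaleE; apply/aclassP; exact: AcScale1. Qed.
Fact ascaleDr : right_distributive ascale +%R.
Proof.
move=> k; elim/apresW=> x; elim/apresW=> y; rewrite /+%R /= aaddE !ascaleE aaddE.
by apply/aclassP; exact: AcScaleDr.
Qed.
Fact ascaleDl u : {morph ascale^~ u : k l / k + l}.
Proof.
move=> k l; elim/apresW: u => x; rewrite [in RHS]/+%R /= !ascaleE aaddE.
by apply/aclassP; exact: AcScaleDl.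
Qed.
HB.instance Definition _ :=
  GRing.Zmodule_isLmodule.Build K apres ascaleA ascale1 ascaleDr ascaleDl.

Lemma aclass0 : aclass AZero = 0.
Proof. by []. Qed.
Lemma aclassD x y : aclass (AAdd x y) = aclass x + aclass y.
Proof. by rewrite -aaddE. Qed.
Lemma aclassN x : aclass (AOpp x) = - aclass x.
Proof. by rewrite -aoppE. Qed.
Lemma aclassZ k x : aclass (AScale k x) = k *: aclass x.
Proof. by rewrite -ascaleE. Qed.

Fact amulA : associative amul.
Proof.
elim/apresW=> x; elim/apresW=> y; elim/apresW=> z; rewrite !amulE.
by apply/aclassP; exact: AcMulA.
Qed.
Fact amulC : commutative amul.
Proof.
by elim/apresW=> x; elim/apresW=> y; rewrite !amulE; apply/aclassP; exact: AcMulC.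
Qed.
Fact amul_bilin : bilin (amul : apres -> apres -> apres).
Proof.
have linl v : linear (amul^~ v : apres -> apres).
  move=> k; elim/apresW=> x; elim/apresW=> y; elim/apresW: v => z.
  rewrite -aclassZ -aclassD !amulE -aclassZ -aclassD; apply/aclassP.
  apply: AcTrans (AcMulDl _ _ _ _) _; apply: AcAdd (AcRefl _ _).
  exact: AcMulZl.
by split=> // u k x y; rewrite !(amulC u) linl.
Qed.
HB.instance Definition _ := Lmodule_isNUAlgebra.Build K apres amulA amul_bilin.
HB.instance Definition _ := NUAlgebra_isComm.Build K apres amulC.

Lemma aclassM x y : aclass (AMul x y) = aclass x ∙ aclass y.
Proof. by rewrite -amulE. Qed.
End AlgebraPresentation.

Section RepresentationAlgebra.
Variables (K : comPzRingType) (A : nuAlgType K) (M : coalgType K).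

(* RepM ranges over all expansions of comul α; by bilinearity the right-hand *)
(* side does not depend on the expansion.                                   *)
Inductive rep_rel : aterm K (A * M) -> aterm K (A * M) -> Prop :=
  | RepDl a b α : rep_rel (AGen (a + b, α)) (AAdd (AGen (a, α)) (AGen (b, α)))
  | RepDr a α β : rep_rel (AGen (a, α + β)) (AAdd (AGen (a, α)) (AGen (a, β)))
  | RepZl k a α : rep_rel (AGen (k *: a, α)) (AScale k (AGen (a, α)))
  | RepZr k a α : rep_rel (AGen (a, k *: α)) (AScale k (AGen (a, α)))
  | RepM a b α (s : seq (M * M)) :
      comul α = \sum_(p <- s) p.1 ⊗ p.2 ->
      rep_rel (AGen (a ∙ b, α))
        (\big[@AAdd _ _/AZero]_(p <- s) AMul (AGen (a, p.1)) (AGen (b, p.2))).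

Definition rep_alg := apres rep_rel.
HB.instance Definition _ := ComNUAlgebra.on rep_alg.

Definition rep_gen (a : A) (α : M) : rep_alg := aclass rep_rel (AGen (a, α)).
End RepresentationAlgebra.

Section DoublePoisson.
Variables (K : comPzRingType) (A : nuAlgType K).

Definition lmul (a x : A) : A := a ∙ x.
Definition rmul (b x : A) : A := x ∙ b.
HB.instance Definition _ a :=
  GRing.isLinear.Build K A A _ (lmul a) ((@nmul_bilin K A).2 a).
HB.instance Definition _ b :=
  GRing.isLinear.Build K A A _ (rmul b) ((@nmul_bilin K A).1 b).

(* The outer actions a (x ⊗ y) = ax ⊗ y and (x ⊗ y) b = x ⊗ yb. *)
Definition outl (a : A) : A ⊗ A -> A ⊗ A := tmap (lmul a) idfun.
Definition outr (t : A ⊗ A) (b : A) : A ⊗ A := tmap idfun (rmul b) t.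
(* The inner actions a * (x ⊗ y) = x ⊗ ay and (x ⊗ y) * b = xb ⊗ y. *)
Definition innl (a : A) : A ⊗ A -> A ⊗ A := tmap idfun (lmul a).
Definition innr (t : A ⊗ A) (b : A) : A ⊗ A := tmap (rmul b) idfun t.

Definition P312 : A ⊗ (A ⊗ A) -> A ⊗ (A ⊗ A) :=
  fun t => tswap (tassocV t).
Definition P312V : A ⊗ (A ⊗ A) -> A ⊗ (A ⊗ A) :=
  fun t => tassoc (tswap t).

Lemma P312E a b c : P312 (a ⊗ (b ⊗ c)) = c ⊗ (a ⊗ b).
Proof. by rewrite /P312 tassocVE tswapE. Qed.

Lemma tswapK (U V : lmodType K) : cancel (@tswap K U V) (@tswap K V U).
Proof.
move=> t; have [s ->] := tensor_expand t; rewrite !linear_sum.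
by apply: eq_bigr => p _ /=; rewrite !tswapE.
Qed.
Lemma P312K : cancel P312 P312V.
Proof. by move=> t; rewrite /P312V /P312 tswapK tassocVK. Qed.
Lemma P312VK : cancel P312V P312.
Proof. by move=> t; rewrite /P312V /P312 tassocK tswapK. Qed.

Variable db : {linear (A ⊗ A)%type -> (A ⊗ A)%type}.

Definition tribracket (t : A ⊗ (A ⊗ A)) : A ⊗ (A ⊗ A) :=
  \sum_(i < 3)
    iter i P312
      (tassoc (tmap db (idfun : {linear A -> A})
        (tassocV (tmap (idfun : {linear A -> A}) db (iter i P312V t))))).

Record double_poisson : Prop := DoublePoisson {
  dp_antisym : forall a b, db (b ⊗ a) = - tswap (db (a ⊗ b));
  dp_leibnizr : forall a b c,
    db (a ⊗ (b ∙ c)) = outr (db (a ⊗ b)) c + outl b (db (a ⊗ c));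
  dp_leibnizl : forall a b c,
    db ((a ∙ b) ⊗ c) = innl a (db (b ⊗ c)) + innr (db (a ⊗ c)) b;
  dp_jacobi : forall t, tribracket t = 0
}.
End DoublePoisson.

Section CyclicForm.
Variables (K : comPzRingType) (M : coalgType K) (v : {linear (M ⊗ M)%type -> K^o}).

Definition comul3 (β : M) : M ⊗ (M ⊗ M) :=
  tmap (idfun : {linear M -> M}) comul (comul β).

Lemma contract_bilin (α : M) : bilin (fun β γ : M => (v (α ⊗ β) : K) *: γ).
Proof.
split=> [γ|β] k x y; last by rewrite scalerDr !scalerA mulrC.
by rewrite !linearP scalerDl scalerA.
Qed.
Definition contract (α : M) : M ⊗ M -> M := tlift (contract_bilin α).
HB.instance Definition _ α := GRing.Linear.on (contract α).

Lemma vhat_bilin :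
  bilin (fun α β : M => tmap (idfun : {linear M -> M}) (contract α) (comul3 β)).
Proof.
split=> [β|α] k x y; last by rewrite /comul3 !linearP.
have [s ->] := tensor_expand (comul3 β).
rewrite !linear_sum -big_split; apply: eq_bigr => -[b t] _ /=.
rewrite !tmapE -linearP; congr (_ ⊗ _); have [s' ->] := tensor_expand t.
rewrite !linear_sum -big_split; apply: eq_bigr => -[c d] _ /=.
rewrite /contract !tliftE ((tpure_bilin _ _).1) linearP.
by rewrite scalerDl scalerA.
Qed.
Definition vhat : M ⊗ M -> M ⊗ M := tlift vhat_bilin.
HB.instance Definition _ := GRing.Linear.on vhat.

Lemma vhatE α β (s : seq (M * (M * M))) :
  comul3 β = \sum_(p <- s) p.1 ⊗ (p.2.1 ⊗ p.2.2) ->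
  vhat (α ⊗ β) = \sum_(p <- s) (v (α ⊗ p.2.1) : K) *: (p.1 ⊗ p.2.2).
Proof.
move=> βE; rewrite /vhat tliftE βE linear_sum; apply: eq_bigr => p _ /=.
by rewrite tmapE /= /contract tliftE linearZ.
Qed.

Definition cyclic_form : Prop := forall t, vhat (tswap t) = tswap (vhat t).
End CyclicForm.

Record poisson_bracket (K : comPzRingType) (C : comNuAlgType K)
    (br : C -> C -> C) : Prop := PoissonBracket {
  pb_bilin : bilin br;
  pb_antisym : forall x y, br x y = - br y x;
  pb_leibnizr : forall x y z, br x (y ∙ z) = br x y ∙ z + y ∙ br x z;
  pb_leibnizl : forall x y z, br (x ∙ y) z = x ∙ br y z + br x z ∙ y;
  pb_jacobi : forall x y z, br x (br y z) + br y (br z x) + br z (br x y) = 0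
}.

(* Main.v *)
Require Import Defs.
From HB Require Import structures.
From mathcomp Require Import all_boot all_algebra.
From mathcomp Require Import boolp.

(** Uniqueness is the principle that a derivation of [rep_alg A M] is determined
by its values on the generators (lemma [derivation_ext]), applied to one
argument of the bracket after the other.

For existence, let B be the proposed value on generators.  Extend it to a
derivation in the second argument for each generator in the first one, then
extend the result in the first argument.  Each extension requires B to respect
the relation for (ab)_α ([coleibniz]).  In the second argument this follows from
the right Leibniz rule of the double bracket and from the fact that
V_α = v^(α ⊗ -) : M -> M ⊗ M is a morphism of bicomodules for the outer
structure on M ⊗ M ([comulr_vhat], [comull_vhat]), a form of coassociativity.
The first argument needs no separate computation: B is skew ([gen_bracketN]),
because the double bracket changes sign under the flip, v^ commutes with it, and
[rep_alg A M] is commutative.  Skewness of B passes to the bracket by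
[derivation_ext].

The Jacobi sum is a derivation in each argument, so it suffices to treat
generators ([jacobiator_eq0]).  There, write D(a,b,c) for the double bracket
of a with the left factor of the double bracket of b and c, an element of the
third tensor power of A, and Φ(α,β,γ) = (V_α ⊗ 1) V_β(γ) for its analogue in M.
Let Θ(a_α,b_β,c_γ) in [rep_alg A M] be obtained by decorating the factors of
D(a,b,c) with those of Φ(α,β,γ) and multiplying.  Then
{a_α, {b_β, c_γ}} = Θ(a_α,b_β,c_γ) - Θ(a_α,c_γ,b_β) ([bracket_bracket]):
the two terms come from the Leibniz rule for the product of the two factors of
{b_β, c_γ}, and the second is brought to the form Θ by skewness together with
  - (V_α ⊗ 1) V_β = (1 ⊗ V_β) V_α, by coassociativity ([vhat_at_comm]);
  - the invariance of Φ under simultaneous cyclic rotation of its arguments and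
    of its tensor factors, by cyclicity of v ([double_vhat_rot]).
By the same invariance and by commutativity of [rep_alg A M], the sum of Θ over
the cyclic rotations of its arguments is the tribracket decorated with
Φ(α,β,γ), hence zero.  The Jacobi sum is a difference of two such sums. *)

Import GRing.Theory.
Local Open Scope ring_scope.

Set Implicit Arguments.
Unset Strict Implicit.
Unset Printing Implicit Defensive.

(** * Bilinear maps and tensor products *)

Section Bilinear.
Variables (K : comPzRingType) (U V W : lmodType K) (f : U -> V -> W).
Hypothesis fb : bilin f.

Let fl v : {linear U -> W} :=
  HB.pack (f^~ v) (GRing.isLinear.Build K U W _ (f^~ v) (fb.1 v)).
Let fr u : {linear V -> W} :=
  HB.pack (f u) (GRing.isLinear.Build K V W _ (f u) (fb.2 u)).

Lemma bilin0l v : f 0 v = 0. Proof. exact: (linear0 (fl v)). Qed.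
Lemma bilin0r u : f u 0 = 0. Proof. exact: (linear0 (fr u)). Qed.
Lemma bilinDl v : {morph f^~ v : x y / x + y}. Proof. exact: (linearD (fl v)). Qed.
Lemma bilinDr u : {morph f u : x y / x + y}. Proof. exact: (linearD (fr u)). Qed.
Lemma bilinNl v : {morph f^~ v : x / - x}. Proof. exact: (linearN (fl v)). Qed.
Lemma bilinNr u : {morph f u : x / - x}. Proof. exact: (linearN (fr u)). Qed.
Lemma bilinZl v k u : f (k *: u) v = k *: f u v.
Proof. exact: (linearZ_LR (fl v)). Qed.
Lemma bilinZr u k v : f u (k *: v) = k *: f u v.
Proof. exact: (linearZ_LR (fr u)). Qed.
Lemma bilin_suml I (s : seq I) (F : I -> U) v :
  f (\sum_(i <- s) F i) v = \sum_(i <- s) f (F i) v.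
Proof. exact: (linear_sum (fl v)). Qed.
Lemma bilin_sumr I (s : seq I) (F : I -> V) u :
  f u (\sum_(i <- s) F i) = \sum_(i <- s) f u (F i).
Proof. exact: (linear_sum (fr u)). Qed.
End Bilinear.

Section TensorIdentities.
Variable K : comPzRingType.
Implicit Types U V W : lmodType K.

Lemma tensor_ind U V (P : U ⊗ V -> Prop) :
  (forall u v, P (u ⊗ v)) -> P 0 -> (forall s t, P s -> P t -> P (s + t)) ->
  forall t, P t.
Proof.
move=> Pp P0 PD t; have [s ->] := tensor_expand t.
by elim/big_ind: _ => // p _; exact: Pp.
Qed.

Lemma eq_tmap U U' V V' (f f' : {linear U -> U'}) (g g' : {linear V -> V'}) :
  f =1 f' -> g =1 g' -> tmap f g =1 tmap f' g'.
Proof. by move=> ff' gg'; apply: tensor_ext => u v /=; rewrite !tmapE ff' gg'. Qed.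

Lemma tmap_comp U U' U'' V V' V'' (f : {linear U' -> U''}) (g : {linear V' -> V''})
    (f' : {linear U -> U'}) (g' : {linear V -> V'}) t :
  tmap f g (tmap f' g' t) = tmap (f \o f') (g \o g') t.
Proof.
elim/tensor_ind: t => [u v||s t IHs IHt]; first by rewrite !tmapE.
- by rewrite !linear0.
- by rewrite !linearD /= IHs IHt.
Qed.

Lemma tmap_id U V (t : U ⊗ V) : tmap idfun idfun t = t.
Proof.
elim/tensor_ind: t => [u v||s t IHs IHt]; first by rewrite tmapE.
- by rewrite linear0.
- by rewrite linearD /= IHs IHt.
Qed.

Lemma tassoc_tmap U U' V V' W W' (f : {linear U -> U'}) (g : {linear V -> V'})
    (h : {linear W -> W'}) t :
  tassoc (tmap (tmap f g) h t) = tmap f (tmap g h) (tassoc t).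
Proof.
elim/tensor_ind: t => [r w||s t IHs IHt]; first 1 last.
- by rewrite !linear0.
- by rewrite !linearD /= IHs IHt.
elim/tensor_ind: r => [u v||s t IHs IHt].
- by rewrite tmapE /= tmapE !tassocE !tmapE /= tmapE.
- by rewrite (bilin0l (tpure_bilin _ _)) !linear0.
- by rewrite (bilinDl (tpure_bilin _ _)) !linearD /= IHs IHt.
Qed.

Lemma tassocV_tmap U U' V V' W W' (f : {linear U -> U'}) (g : {linear V -> V'})
    (h : {linear W -> W'}) t :
  tassocV (tmap f (tmap g h) t) = tmap (tmap f g) h (tassocV t).
Proof. by rewrite -{1}[t]tassocVK -tassoc_tmap tassocK. Qed.
End TensorIdentities.

(** * The outer bicomodule structure and the form *)

Section CyclicForm.
Variables (K : comPzRingType) (M : coalgType K) (v : {linear (M ⊗ M)%type -> K^o}).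
Implicit Types α β γ : M.

(** In Sweedler notation, γ |-> v(α ⊗ γ^1) γ^2; thus [vhat v (α ⊗ -)] is
[tmap idfun (vcut α)] after a single comultiplication. *)
Definition vcut α : M -> M := contract v α \o comul.
HB.instance Definition _ α := GRing.Linear.on (vcut α).
Definition vhat_at α : M -> M ⊗ M := vhat v \o tpure α.
HB.instance Definition _ α := GRing.Linear.on (vhat_at α).

Lemma vhat_atE α β : vhat_at α β = tmap idfun (vcut α) (comul β).
Proof. by rewrite /vhat_at /= /vhat tliftE /comul3 tmap_comp; exact: eq_tmap. Qed.

Lemma comulAV β :
  tassocV (tmap idfun comul (comul β)) =
  tmap comul idfun (comul β) :> ((M ⊗ M) ⊗ M)%type.
Proof. by rewrite -comulA tassocK. Qed.

Lemma contractE α β γ : contract v α (β ⊗ γ) = (v (α ⊗ β) : K) *: γ.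
Proof. exact: tliftE. Qed.

(** The contraction consumes only the leftmost factor, so it commutes with
comultiplication on the right. *)
Lemma comul_vcut α γ : comul (vcut α γ) = tmap (vcut α) idfun (comul γ).
Proof.
have cutE t : comul (contract v α t) =
    tmap (contract v α) idfun (tassocV (tmap idfun comul t)).
  elim/tensor_ind: t => [x y||s t IHs IHt]; first 1 last.
  - by rewrite !linear0.
  - by rewrite !linearD /= IHs IHt.
  rewrite tmapE /= contractE linearZ.
  have [s ->] := tensor_expand (comul y).
  rewrite !linear_sum /= !linear_sum; apply: eq_bigr => p _ /=.
  by rewrite tassocVE tmapE /= contractE (bilinZl (tpure_bilin _ _)).
rewrite /vcut /= cutE comulAV tmap_comp; exact: eq_tmap.
Qed.

(** With the next lemma: [vhat_at α] is a morphism of bicomodules for the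
coactions on the outer sides of M ⊗ M.  This is what makes the bracket
compatible with the relation for (ab)_α. *)
Lemma comulr_vhat α β :
  tmap idfun comul (vhat_at α β) = tassoc (tmap (vhat_at α) idfun (comul β)).
Proof.
transitivity (tmap idfun (tmap (vcut α) idfun) (tmap idfun comul (comul β))).
  rewrite vhat_atE !tmap_comp; apply: eq_tmap => // x; exact: comul_vcut.
rewrite -comulA -tassoc_tmap tmap_comp.
by congr tassoc; apply: eq_tmap => // x; rewrite /= vhat_atE.
Qed.

Lemma comull_vhat α β :
  tmap comul idfun (vhat_at α β) = tassocV (tmap idfun (vhat_at α) (comul β)).
Proof.
transitivity (tmap (tmap idfun idfun) (vcut α) (tmap comul idfun (comul β))).
  rewrite vhat_atE !tmap_comp; apply: eq_tmap => // x /=.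
  by rewrite tmap_id.
rewrite -comulAV -tassocV_tmap tmap_comp.
by congr tassocV; apply: eq_tmap => // x; rewrite /= vhat_atE.
Qed.

Lemma vhat_at_vcut α β γ :
  vhat_at β (vcut α γ) = tmap (vcut α) idfun (vhat_at β γ).
Proof. by rewrite !vhat_atE comul_vcut !tmap_comp; exact: eq_tmap. Qed.

(** Both sides are v(α ⊗ γ^2) v(β ⊗ γ^4) γ^1 ⊗ γ^3 ⊗ γ^5: the two
contractions take place in separate slots, so their order does not matter. *)
Lemma vhat_at_comm α β γ :
  tassoc (tmap (vhat_at α) idfun (vhat_at β γ)) =
  tmap idfun (vhat_at β) (vhat_at α γ).
Proof.
transitivity (tmap idfun (tmap (vcut α) idfun) (tmap idfun (vhat_at β) (comul γ))).
  rewrite -[tmap idfun (vhat_at β) _]tassocVK -comull_vhat -tassoc_tmap tmap_comp.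
  by congr tassoc; apply: eq_tmap => // x; rewrite /= vhat_atE.
rewrite (vhat_atE α γ) !tmap_comp; apply: eq_tmap => // x.
by rewrite /= vhat_at_vcut.
Qed.
End CyclicForm.

(** * Derivations of commutative algebras *)

Section Derivations.
Variables (K : comPzRingType) (C : comNuAlgType K).
Implicit Types (D E : C -> C) (x y z : C).

Record derivation D : Prop := Derivation {
  der_linear : linear D;
  der_leibniz : forall x y, D (x ∙ y) = D x ∙ y + x ∙ D y
}.

Let mb : bilin (@nmul K C) := nmul_bilin.

Lemma derivationNE D x : derivation D -> D (- x) = - D x.
Proof.
move=> [Dl _]; have D0 : D 0 = 0.
  by have := Dl (- 1) 0 0; rewrite scaler0 addr0 scaleN1r addNr.
by have := Dl (- 1) x 0; rewrite D0 !addr0 !scaleN1r.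
Qed.

Lemma derivation_lin k D E :
  derivation D -> derivation E -> derivation (fun x => k *: D x + E x).
Proof.
move=> [Dl DM] [El EM]; split=> [l x y|x y].
  by rewrite Dl El !scalerDr !scalerA addrACA mulrC.
rewrite DM EM (bilinDl mb) (bilinDr mb) (bilinZl mb) (bilinZr mb) scalerDr.
exact: addrACA.
Qed.

Lemma derivation0 : derivation (fun=> 0).
Proof.
split=> [k x y|x y]; first by rewrite scaler0 addr0.
by rewrite (bilin0l mb) (bilin0r mb) addr0.
Qed.

Lemma derivationD D E : derivation D -> derivation E -> derivation (fun x => D x + E x).
Proof.
move=> Dd Ed; rewrite (_ : (fun _ => _) = fun x => 1 *: D x + E x).
  exact: derivation_lin.
by apply/funext => x; rewrite scale1r.
Qed.

Lemma derivationN D : derivation D -> derivation (fun x => - D x).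
Proof.
move=> Dd; rewrite (_ : (fun _ => _) = fun x => (- 1) *: D x + 0).
  exact: derivation_lin Dd derivation0.
by apply/funext => x; rewrite scaleN1r addr0.
Qed.

Lemma derivation_sum I (s : seq I) (D : I -> C -> C) :
  (forall i, derivation (D i)) -> derivation (fun x => \sum_(i <- s) D i x).
Proof.
move=> Dd; elim: s => [|i s IHs].
  rewrite (_ : (fun _ => _) = fun=> 0); first exact: derivation0.
  by apply/funext => x; rewrite big_nil.
rewrite (_ : (fun _ => _) = fun x => D i x + \sum_(j <- s) D j x).
  exact: derivationD.
by apply/funext => x; rewrite big_cons.
Qed.

Lemma derivation_mull c D : derivation D -> derivation (fun x => c ∙ D x).
Proof.
move=> [Dl DM]; split=> [k x y|x y].
  by rewrite Dl (bilinDr mb) (bilinZr mb).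
by rewrite DM (bilinDr mb) !nmulA [c ∙ x]nmulC.
Qed.

Lemma derivation_mulr c D : derivation D -> derivation (fun x => D x ∙ c).
Proof.
move=> Dd; rewrite (_ : (fun _ => _) = fun x => c ∙ D x); first exact: derivation_mull.
by apply/funext => x; rewrite nmulC.
Qed.

(** The mixed terms D x ∙ E y and E x ∙ D y occur once with each sign. *)
Lemma derivation_comm D E :
  derivation D -> derivation E -> derivation (fun x => D (E x) - E (D x)).
Proof.
move=> [Dl DM] [El EM].
have DD x y : D (x + y) = D x + D y by have := Dl 1 x y; rewrite !scale1r.
have ED x y : E (x + y) = E x + E y by have := El 1 x y; rewrite !scale1r.
split=> [k x y|x y].
  by rewrite El Dl El Dl opprD addrACA scalerBr.
rewrite EM DD !DM ED !EM (bilinDl mb) (bilinDr mb) (bilinNl mb) (bilinNr mb).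
have cancel_mixed (p q r s p' s' : C) :
    p + q + (r + s) - (p' + r + (q + s')) = p - p' + (s - s').
  rewrite (addrC r s) (addrC q s') addrACA (addrACA p') (addrC r q).
  by rewrite opprD (addrACA (p + s)) subrr addr0 opprD addrACA.
exact: cancel_mixed.
Qed.
End Derivations.

(** * Derivations of a presented algebra *)

Section PresentedDerivation.
Variables (K : comPzRingType) (G : Type) (R : aterm K G -> aterm K G -> Prop).
Variable f : G -> apres R.

(** The Leibniz rule needs the factors as well as their derivatives; they
enter through their classes, so that only congruence of terms has to be
checked to descend to the quotient. *)
Fixpoint aderiv_term (x : aterm K G) : apres R :=
  match x with
  | AGen g => f g
  | AZero => 0
  | AAdd x y => aderiv_term x + aderiv_term y
  | AOpp x => - aderiv_term x
  | AScale k x => k *: aderiv_term x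
  | AMul x y => aderiv_term x ∙ aclass R y + aclass R x ∙ aderiv_term y
  end.

Definition aderiv (u : apres R) : apres R := aderiv_term (arepr u).

Hypothesis fR : forall x y, R x y -> aderiv_term x = aderiv_term y.

Let mb : bilin (@nmul K (apres R)) := nmul_bilin.

Lemma aderiv_term_cong x y : acong R x y -> aderiv_term x = aderiv_term y.
Proof.
elim=> //=.
- by move=> {}x {}y z _ -> _ ->.
- by move=> {}x x' {}y y' _ -> _ ->.
- by move=> {}x x' _ ->.
- by move=> k {}x x' _ ->.
- by move=> {}x x' {}y y' /aclassP-> -> /aclassP-> ->.
- by move=> *; rewrite addrA.
- by move=> *; rewrite addrC.
- by move=> *; rewrite add0r.
- by move=> *; rewrite addNr.
- by move=> *; rewrite scalerA.
- by move=> *; rewrite scale1r.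
- by move=> *; rewrite scalerDr.
- by move=> *; rewrite scalerDl.
- move=> {}x {}y z; rewrite !aclassM (bilinDl mb) (bilinDr mb) !nmulA.
  by rewrite addrA.
- by move=> {}x {}y; rewrite addrC ![_ ∙ aderiv_term _]nmulC.
- move=> {}x {}y z; rewrite aclassD !(bilinDl mb).
  exact: addrACA.
- by move=> k {}x {}y; rewrite aclassZ !(bilinZl mb) scalerDr.
Qed.

Lemma aderiv_class x : aderiv (aclass R x) = aderiv_term x.
Proof. exact: aderiv_term_cong (arepr_class R x). Qed.

Lemma aderiv_derivation : derivation aderiv.
Proof.
split=> [k|]; elim/apresW=> x; elim/apresW=> y.
  by rewrite -aclassZ -aclassD !aderiv_class.
by rewrite -aclassM !aderiv_class.
Qed.
End PresentedDerivation.

(** * Derivations and biderivations of the representation algebra *)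

Section RepDerivations.
Variables (K : comPzRingType) (A : nuAlgType K) (M : coalgType K).
Local Notation C := (rep_alg A M).
Let mb : bilin (@nmul K C) := nmul_bilin.

Lemma rep_gen_bilin : bilin (@rep_gen K A M).
Proof.
split=> [α|a] k x y; rewrite /rep_gen -aclassZ -aclassD; apply/aclassP.
- apply: AcTrans (AcRel (RepDl _ _ _)) _.
  by apply: AcAdd; [exact/AcRel/RepZl | exact: AcRefl].
- apply: AcTrans (AcRel (RepDr _ _ _)) _.
  by apply: AcAdd; [exact/AcRel/RepZr | exact: AcRefl].
Qed.

Lemma rep_genM (a b : A) (α : M) (s : seq (M * M)) :
  comul α = \sum_(p <- s) p.1 ⊗ p.2 ->
  rep_gen (a ∙ b) α = \sum_(p <- s) rep_gen a p.1 ∙ rep_gen b p.2.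
Proof.
move=> αE; have -> : rep_gen (a ∙ b) α = aclass (@rep_rel K A M)
    (\big[@AAdd _ _/AZero]_(p <- s) AMul (AGen (a, p.1)) (AGen (b, p.2))).
  exact/aclassP/AcRel/RepM.
elim: s {αE} => [|p s IHs]; first by rewrite !big_nil.
by rewrite !big_cons aclassD aclassM IHs.
Qed.

(** The difference of the two derivations vanishes on generators, and the
kernel of a derivation is a subalgebra. *)
Lemma derivation_ext (D E : C -> C) : derivation D -> derivation E ->
  (forall a α, D (rep_gen a α) = E (rep_gen a α)) -> D =1 E.
Proof.
move=> Dd Ed DE; suff D0 x : D x - E x = 0 by move=> x; apply/eqP; rewrite -subr_eq0 D0.
have [Fl FM] : derivation (fun x => D x - E x) by exact: derivationD (derivationN Ed).
have F0 (a : A) α : D (rep_gen a α) - E (rep_gen a α) = 0 by rewrite DE subrr.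
have Fz : D 0 - E 0 = 0 by have := Fl (- 1) 0 0; rewrite scaler0 addr0 scaleN1r addNr.
have FZ k x0 : D (k *: x0) - E (k *: x0) = k *: (D x0 - E x0).
  by have := Fl k x0 0; rewrite Fz !addr0.
elim/apresW: x; elim=> [[a α]||x IHx y IHy|x IHx|k x IHx|x IHx y IHy] //.
- exact: F0.
- by rewrite aclassD -[aclass _ x]scale1r Fl IHx IHy scaler0 addr0.
- by rewrite aclassN -scaleN1r FZ IHx scaler0.
- by rewrite aclassZ FZ IHx scaler0.
- by rewrite aclassM FM IHx IHy (bilin0l mb) (bilin0r mb) addr0.
Qed.

(** The condition under which f, seen as a map on generators, respects the
relation (ab)_α = a_α^1 b_α^2 when it is extended by the Leibniz rule. *)
Definition coleibniz (f : A -> M -> C) := forall a b α (s : seq (M * M)),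
  comul α = \sum_(p <- s) p.1 ⊗ p.2 ->
  f (a ∙ b) α = \sum_(p <- s) (f a p.1 ∙ rep_gen b p.2 + rep_gen a p.1 ∙ f b p.2).

Definition rep_deriv (f : A -> M -> C) : C -> C :=
  aderiv (fun g : A * M => f g.1 g.2).

Section Extension.
Variable f : A -> M -> C.
Hypotheses (fb : bilin f) (fM : coleibniz f).

Let fR x y : @rep_rel K A M x y ->
  aderiv_term (fun g : A * M => f g.1 g.2) x = aderiv_term (fun g : A * M => f g.1 g.2) y.
Proof.
case=> /= [a b α|a α β|k a α|k a α|a b α s αE].
- exact: bilinDl.
- exact: bilinDr.
- exact: bilinZl.
- exact: bilinZr.
rewrite (fM _ _ αE); elim: s {αE} => [|p s IHs]; first by rewrite !big_nil.
by rewrite !big_cons /= IHs.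
Qed.

Lemma rep_deriv_derivation : derivation (rep_deriv f).
Proof. exact: aderiv_derivation. Qed.

Lemma rep_derivE a α : rep_deriv f (rep_gen a α) = f a α.
Proof. exact: (aderiv_class fR). Qed.
End Extension.

Section SkewBiderivation.
Variable B : A -> M -> A -> M -> C.
Hypothesis Bb : forall a α, bilin (B a α).
Hypothesis BM : forall a α, coleibniz (B a α).
Hypothesis BN : forall a α b β, B a α b β = - B b β a α.

Let hamiltonian a α := rep_deriv (B a α).
Let hamiltonian_derivation a α : derivation (hamiltonian a α).
Proof. exact: rep_deriv_derivation. Qed.
Let hamiltonianE a α b β : hamiltonian a α (rep_gen b β) = B a α b β.
Proof. exact: rep_derivE. Qed.

(** For this lemma and the next, both sides are derivations in y; on generators
the identity is the corresponding property of B in its last two arguments,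
transported by skewness. *)
Lemma hamiltonian_bilin y : bilin (fun a α => hamiltonian a α y).
Proof.
split=> [α|a] k x x'; move: y; apply: derivation_ext => //.
- exact: derivation_lin.
- by move=> b β; rewrite !hamiltonianE !(BN _ _ b) (Bb b β).1 opprD scalerN.
- exact: derivation_lin.
- by move=> b β; rewrite !hamiltonianE !(BN _ _ b) (Bb b β).2 opprD scalerN.
Qed.

Lemma hamiltonian_coleibniz y : coleibniz (fun a α => hamiltonian a α y).
Proof.
move=> a b α s αE; move: y; apply: derivation_ext => // [|c γ].
  by apply: derivation_sum => p; apply: derivationD;
    [exact: derivation_mulr | exact: derivation_mull].
rewrite hamiltonianE BN (BM _ _ _ _ αE) -sumrN; apply: eq_bigr => p _.
by rewrite !hamiltonianE !(BN _ _ c) (bilinNl mb) (bilinNr mb) opprD.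
Qed.

Definition rep_bracket x y := rep_deriv (fun a α => hamiltonian a α y) x.

Lemma rep_bracket_derivationl y : derivation (rep_bracket^~ y).
Proof. exact: rep_deriv_derivation (hamiltonian_bilin y) (hamiltonian_coleibniz y). Qed.
Local Lemma rep_bracket_genl a α y : rep_bracket (rep_gen a α) y = hamiltonian a α y.
Proof. exact: rep_derivE (hamiltonian_bilin y) (hamiltonian_coleibniz y) _ _. Qed.

Let brl := rep_bracket_derivationl.

Lemma rep_bracketE a α b β : rep_bracket (rep_gen a α) (rep_gen b β) = B a α b β.
Proof. by rewrite rep_bracket_genl hamiltonianE. Qed.

Lemma rep_bracket_derivationr x : derivation (rep_bracket x).
Proof.
split=> [k y z|y z]; move: x; apply: derivation_ext => //.
- exact: derivation_lin.
- by move=> a α; rewrite !rep_bracket_genl (der_linear (hamiltonian_derivation a α)).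
- by apply: derivationD; [exact: derivation_mulr | exact: derivation_mull].
- by move=> a α; rewrite !rep_bracket_genl (der_leibniz (hamiltonian_derivation a α)).
Qed.

(** Both sides are biderivations, so they can be compared on generators, in one
argument and then in the other. *)
Lemma rep_bracketN x y : rep_bracket x y = - rep_bracket y x.
Proof.
have brN b β z : rep_bracket z (rep_gen b β) = - rep_bracket (rep_gen b β) z.
  move: z; apply: derivation_ext => // [|a α].
    exact: derivationN (rep_bracket_derivationr _).
  by rewrite !rep_bracketE.
move: x; apply: derivation_ext => // [|a α]; last by rewrite brN opprK.
exact: derivationN (rep_bracket_derivationr _).
Qed.
End SkewBiderivation.

Section Jacobi.
Variable br : C -> C -> C.
Hypothesis brd : forall x, derivation (br x).
Hypothesis brN : forall x y, br x y = - br y x.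

Definition jacobiator x y z := br x (br y z) + br y (br z x) + br z (br x y).

Lemma jacobiatorC x y z : jacobiator x y z = jacobiator y z x.
Proof. by rewrite /jacobiator -addrA addrC. Qed.

(** Up to skewness the jacobiator is [br x, br y] - br (br x y), a commutator of
derivations minus a derivation. *)
Lemma jacobiator_derivation x y : derivation (jacobiator x y).
Proof.
have brNr u w : br u (- w) = - br u w by exact: derivationNE.
suff [d dd ->] : exists2 d, derivation d & jacobiator x y = d by [].
exists (fun z => br x (br y z) - br y (br x z) + - br (br x y) z); last first.
  by apply/funext => z; rewrite /jacobiator (brN z x) brNr (brN z).
by apply: derivationD; [exact: derivation_comm | exact: derivationN].
Qed.

Lemma jacobiator_eq0 :
  (forall a α b β c γ,
     jacobiator (rep_gen a α) (rep_gen b β) (rep_gen c γ) = 0) ->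
  forall x y z, jacobiator x y z = 0.
Proof.
have ext x y : (forall c γ, jacobiator x y (rep_gen c γ) = 0) ->
    forall z, jacobiator x y z = 0.
  by apply: derivation_ext; [exact: jacobiator_derivation | exact: derivation0].
(* Cyclic symmetry brings each of the arguments in turn to the last place. *)
move=> J0 x y z; rewrite -jacobiatorC; move: y; apply: (ext _ _) => b β.
rewrite -jacobiatorC; move: x; apply: (ext _ _) => a α.
by rewrite -jacobiatorC; move: z; apply: (ext _ _) => c γ.
Qed.
End Jacobi.
End RepDerivations.

(** * Decorating tensors over A by tensors over M *)

Section Pairing.
Variables (K : comPzRingType) (C : nuAlgType K) (U U' V V' : lmodType K).
Variables (f : U -> V -> C) (g : U' -> V' -> C).
Hypotheses (fb : bilin f) (gb : bilin g).
Let mb : bilin (@nmul K C) := nmul_bilin.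

Lemma pairing_fiber_bilin u u' : bilin (fun x x' => f u x ∙ g u' x').
Proof.
split=> [x'|x] k y z; first by rewrite fb.2 mb.1.
by rewrite gb.2 mb.2.
Qed.

Lemma pairing_bilin_pure (w : V ⊗ V') :
  bilin (fun u u' => tlift (pairing_fiber_bilin u u') w).
Proof.
split=> [u'|u] k y z; elim/tensor_ind: w => [x x'||s t IHs IHt].
- by rewrite !tliftE fb.1 mb.1.
- by rewrite !linear0 addr0.
- by rewrite !linearD /= IHs IHt addrACA.
- by rewrite !tliftE gb.1 mb.2.
- by rewrite !linear0 addr0.
- by rewrite !linearD /= IHs IHt addrACA.
Qed.

(** The bilinear map (u ⊗ u', x ⊗ x') |-> f u x ∙ g u' x'. *)
Definition pairing (t : U ⊗ U') (w : V ⊗ V') : C := tlift (pairing_bilin_pure w) t.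

Lemma pairingE u u' x x' : pairing (u ⊗ u') (x ⊗ x') = f u x ∙ g u' x'.
Proof. by rewrite /pairing !tliftE. Qed.

Lemma pairing_bilin : bilin pairing.
Proof.
split=> [w|t] k x y; first by rewrite /pairing linearP.
elim/tensor_ind: t => [u u'||s t IHs IHt].
- by rewrite /pairing !tliftE linearP.
- by rewrite /pairing !linear0 addr0.
- by rewrite /pairing in IHs IHt *; rewrite !linearD /= IHs IHt addrACA.
Qed.

Lemma pairing_ind (P : U ⊗ U' -> V ⊗ V' -> Prop) :
  (forall u u' x x', P (u ⊗ u') (x ⊗ x')) ->
  (forall t, P t 0) -> (forall w, P 0 w) ->
  (forall t w w', P t w -> P t w' -> P t (w + w')) ->
  (forall t t' w, P t w -> P t' w -> P (t + t') w) ->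
  forall t w, P t w.
Proof.
move=> Pp P0r P0l PDr PDl t w.
elim/tensor_ind: t => [u u'||t t' IHt IHt']; last exact: PDl.
  by elim/tensor_ind: w => [x x'||w w' IHw IHw'] //; exact: PDr.
exact: P0l.
Qed.
End Pairing.

(** [P312] on the third tensor power of an arbitrary module: the argument needs
it for M as well as for A. *)
Definition trot (K : comPzRingType) (U : lmodType K) (t : U ⊗ (U ⊗ U)) : U ⊗ (U ⊗ U) :=
  tswap (tassocV t).

Lemma tmapr_swap (K : comPzRingType) (U : lmodType K) (f : {linear U -> (U ⊗ U)%type}) t :
  tmap idfun f (tswap t) = trot (tassoc (tmap f idfun t)).
Proof.
rewrite /trot tassocK; elim/tensor_ind: t => [x y||s t IHs IHt].
- by rewrite !(tswapE, tmapE).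
- by rewrite !linear0.
- by rewrite !linearD /= IHs IHt.
Qed.

Section Evaluation.
Variables (K : comPzRingType) (A : nuAlgType K) (M : coalgType K).
Local Notation C := (rep_alg A M).
Let mb : bilin (@nmul K C) := nmul_bilin.
Let gb : bilin (@rep_gen K A M) := @rep_gen_bilin K A M.
Let pb (U V : lmodType K) := tpure_bilin U V.

Definition rep2 : A ⊗ A -> M ⊗ M -> C := pairing gb gb.
Definition rep3 : A ⊗ (A ⊗ A) -> M ⊗ (M ⊗ M) -> C :=
  pairing gb (pairing_bilin gb gb).

Lemma rep2_bilin : bilin rep2. Proof. exact: pairing_bilin. Qed.
Lemma rep3_bilin : bilin rep3. Proof. exact: pairing_bilin. Qed.
Let b2 := rep2_bilin.
Let b3 := rep3_bilin.

Lemma rep2E a b α β : rep2 (a ⊗ b) (α ⊗ β) = rep_gen a α ∙ rep_gen b β.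
Proof. exact: pairingE. Qed.

Lemma rep3E a t α w : rep3 (a ⊗ t) (α ⊗ w) = rep_gen a α ∙ rep2 t w.
Proof. exact: pairingE. Qed.

Lemma rep2_sum (s : seq (A * A)) (t : seq (M * M)) :
  rep2 (\sum_(p <- s) p.1 ⊗ p.2) (\sum_(q <- t) q.1 ⊗ q.2) =
  \sum_(p <- s) \sum_(q <- t) rep_gen p.1 q.1 ∙ rep_gen p.2 q.2.
Proof.
rewrite (bilin_suml b2); apply: eq_bigr => p _.
by rewrite (bilin_sumr b2); apply: eq_bigr => q _; rewrite rep2E.
Qed.

(** Simultaneous permutation of the factors is absorbed by commutativity; the
same holds for [rep3_rot]. *)
Lemma rep2_swap t w : rep2 (tswap t) (tswap w) = rep2 t w.
Proof.
elim/pairing_ind: t / w => [a b α β|t|w|t w w' IH IH'|t t' w IH IH'].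
- by rewrite !tswapE !rep2E nmulC.
- by rewrite linear0 !(bilin0r b2).
- by rewrite linear0 !(bilin0l b2).
- by rewrite linearD /= !(bilinDr b2) IH IH'.
- by rewrite linearD /= !(bilinDl b2) IH IH'.
Qed.

Lemma rep3_assoc t c w γ :
  rep3 (tassoc (t ⊗ c)) (tassoc (w ⊗ γ)) = rep2 t w ∙ rep_gen c γ.
Proof.
elim/pairing_ind: t / w => [a b α β|t|w|t w w' IH IH'|t t' w IH IH'].
- by rewrite !tassocE rep3E !rep2E nmulA.
- by rewrite (bilin0l (pb _ _)) linear0 (bilin0r b3) (bilin0r b2) (bilin0l mb).
- by rewrite (bilin0l (pb _ _)) linear0 (bilin0l b3) (bilin0l b2) (bilin0l mb).
- rewrite (bilinDl (pb _ _)) linearD /= (bilinDr b3) IH IH' (bilinDr b2).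
  by rewrite (bilinDl mb).
- rewrite (bilinDl (pb _ _)) linearD /= (bilinDl b3) IH IH' (bilinDl b2).
  by rewrite (bilinDl mb).
Qed.

Lemma rep3_rot t w : rep3 (trot t) (trot w) = rep3 t w.
Proof.
have rot_assoc (r : (A ⊗ A)%type) c (u : (M ⊗ M)%type) γ :
    rep3 (trot (tassoc (r ⊗ c))) (trot (tassoc (u ⊗ γ))) =
    rep3 (tassoc (r ⊗ c)) (tassoc (u ⊗ γ)).
  by rewrite /trot !tassocK !tswapE rep3E rep3_assoc nmulC.
rewrite -(tassocVK t) -(tassocVK w).
elim/pairing_ind: (tassocV t) / (tassocV w) => [r c u γ|?|?|? ? ? IH IH'|? ? ? IH IH'].
- exact: rot_assoc.
- by rewrite /trot !linear0 !(bilin0r b3).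
- by rewrite /trot !linear0 !(bilin0l b3).
- by move: IH IH'; rewrite /trot !linearD /= !(bilinDr b3) => -> ->.
- by move: IH IH'; rewrite /trot !linearD /= !(bilinDl b3) => -> ->.
Qed.

Lemma rep_gen_mul a b α :
  rep_gen (a ∙ b) α = rep2 (a ⊗ b) (comul α).
Proof.
have [s αE] := tensor_expand (comul α).
by rewrite (rep_genM _ _ αE) αE (bilin_sumr b2); apply: eq_bigr => p _; rewrite rep2E.
Qed.

(** With [rep2_outl]: multiplying an outer factor in A corresponds to
comultiplying the matching outer factor in M. *)
Lemma rep2_outr t c w :
  rep2 (outr t c) w = rep3 (tassoc (t ⊗ c)) (tmap idfun comul w).
Proof.
elim/pairing_ind: t / w => [a b α β|t|w|t w w' IH IH'|t t' w IH IH'].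
- by rewrite /outr !tmapE /= tassocE rep3E rep2E /rmul rep_gen_mul.
- by rewrite linear0 (bilin0r b3) (bilin0r b2).
- by rewrite (bilin0l (pb _ _)) /outr !linear0 (bilin0l b3) (bilin0l b2).
- by rewrite linearD /= (bilinDr b3) (bilinDr b2) IH IH'.
- rewrite (bilinDl (pb _ _)) /outr !linearD /= (bilinDl b3) (bilinDl b2).
  by rewrite -IH -IH'.
Qed.

Lemma rep2_outl a t w :
  rep2 (outl a t) w = rep3 (a ⊗ t) (tassoc (tmap comul idfun w)).
Proof.
elim/pairing_ind: t / w => [b c α β|t|w|t w w' IH IH'|t t' w IH IH'].
- rewrite /outl !tmapE /= -tassocE.
  by rewrite rep3_assoc rep2E /lmul rep_gen_mul.
- by rewrite !linear0 (bilin0r b3) (bilin0r b2).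
- by rewrite (bilin0r (pb _ _)) /outl !linear0 (bilin0l b3) (bilin0l b2).
- by rewrite !linearD /= (bilinDr b3) (bilinDr b2) IH IH'.
- rewrite (bilinDr (pb _ _)) /outl !linearD /= (bilinDl b3) (bilinDl b2).
  by rewrite -IH -IH'.
Qed.
End Evaluation.

(** * The bracket on generators *)

Section Bracket.
Variables (K : comPzRingType) (A : nuAlgType K) (M : coalgType K).
Variables (db : {linear (A ⊗ A)%type -> (A ⊗ A)%type}) (v : {linear (M ⊗ M)%type -> K^o}).
Hypotheses (dbP : double_poisson db) (vC : cyclic_form v).
Local Notation C := (rep_alg A M).
Let b2 := @rep2_bilin K A M.
Let b3 := @rep3_bilin K A M.

Definition db_at (a : A) : A -> A ⊗ A := db \o tpure a.
HB.instance Definition _ a := GRing.Linear.on (db_at a).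

Lemma vhat_atC α β : vhat_at v β α = tswap (vhat_at v α β).
Proof. by rewrite /vhat_at /= -(vC (α ⊗ β)) tswapE. Qed.

Lemma db_atC a b : db_at b a = - tswap (db_at a b).
Proof. exact: dp_antisym. Qed.

Definition gen_bracket a α b β : C := rep2 (db_at a b) (vhat_at v α β).

Lemma gen_bracket_bilin a α : bilin (gen_bracket a α).
Proof.
by rewrite /gen_bracket; split=> [β|b] k x y; rewrite linearP ((b2).1, (b2).2).
Qed.

Lemma gen_bracketN a α b β : gen_bracket a α b β = - gen_bracket b β a α.
Proof.
by rewrite /gen_bracket vhat_atC db_atC (bilinNl b2) rep2_swap.
Qed.

(** The two terms of the right Leibniz rule for the double bracket produce the
two terms of the rule in the representation algebra, because [vhat v (α ⊗ -)]
is colinear on the right and on the left. *)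
Lemma gen_bracket_coleibniz a α : coleibniz (gen_bracket a α).
Proof.
move=> b c β s βE; rewrite /gen_bracket /db_at /= dp_leibnizr //.
rewrite (bilinDl b2) rep2_outr rep2_outl comulr_vhat comull_vhat tassocVK.
rewrite βE !linear_sum /= !(bilin_sumr b3) big_split /=; congr (_ + _).
  by apply: eq_bigr => p _; rewrite tmapE /= rep3_assoc.
by apply: eq_bigr => p _; rewrite tmapE /= rep3E.
Qed.

Definition double_db a b c : A ⊗ (A ⊗ A) := tassoc (tmap (db_at a) idfun (db_at b c)).
Definition double_vhat α β γ : M ⊗ (M ⊗ M) :=
  tassoc (tmap (vhat_at v α) idfun (vhat_at v β γ)).

(** Cyclicity of v turns the inner [vhat v (γ ⊗ α)] into the flip of
[vhat v (α ⊗ γ)]; the rest is the exchange rule [vhat_at_comm]. *)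
Lemma double_vhat_rot α β γ : trot (double_vhat β γ α) = double_vhat α β γ.
Proof. by rewrite /double_vhat -tmapr_swap -vhat_atC -vhat_at_comm. Qed.

Lemma double_db_cyclic a b c :
  double_db a b c + trot (double_db b c a) + trot (trot (double_db c a b)) = 0.
Proof.
have dbE x y z : tassoc (tmap db idfun (tassocV (tmap idfun db (x ⊗ (y ⊗ z))))) = double_db x y z.
  rewrite tmapE /= /tassocV tliftE tmap_comp; congr tassoc; exact: eq_tmap.
have := dp_jacobi dbP (a ⊗ (b ⊗ c)).
rewrite /tribracket !big_ord_recl big_ord0 addr0 /= addrA.
by rewrite /P312V /P312 -!/(trot _) !tswapE !tassocE !tswapE !tassocE !dbE.
Qed.

Section Jacobi.
Variable br : C -> C -> C.
Hypothesis brd : forall x, derivation (br x).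
Hypothesis brE : forall a α b β,
  br (rep_gen a α) (rep_gen b β) = gen_bracket a α b β.

Lemma bracket_rep2 a α t w :
  br (rep_gen a α) (rep2 t w) =
  rep3 (tassoc (tmap (db_at a) idfun t)) (tassoc (tmap (vhat_at v α) idfun w)) +
  rep3 (tmap idfun (db_at a) t) (tmap idfun (vhat_at v α) w).
Proof.
have [/= brl brM] := brd (rep_gen a α).
have brD x y : br (rep_gen a α) (x + y) = br (rep_gen a α) x + br (rep_gen a α) y.
  by have := brl 1 x y; rewrite !scale1r.
have br0 : br (rep_gen a α) 0 = 0.
  by apply: (@addrI _ (br (rep_gen a α) 0)); rewrite -brD !addr0.
elim/pairing_ind: t / w => [b c β γ|t|w|t w w' IH IH'|t t' w IH IH'].
- by rewrite rep2E brM !brE !tmapE rep3_assoc rep3E.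
- by rewrite (bilin0r b2) br0 !linear0 !(bilin0r b3) addr0.
- by rewrite (bilin0l b2) br0 !linear0 !(bilin0l b3) addr0.
- by rewrite (bilinDr b2) brD IH IH' !linearD /= !(bilinDr b3) addrACA.
- by rewrite (bilinDl b2) brD IH IH' !linearD /= !(bilinDl b3) addrACA.
Qed.

Definition double_term a α b β c γ : C := rep3 (double_db a b c) (double_vhat α β γ).

(** The Leibniz rule gives one term for each factor of [br b c].  The
bracket with the right factor becomes, after a flip of the double bracket of
b and c, minus a rotated bracket with the left factor of that of c and b. *)
Lemma bracket_bracket a α b β c γ :
  br (rep_gen a α) (br (rep_gen b β) (rep_gen c γ)) =
  double_term a α b β c γ - double_term a α c γ b β.
Proof.
rewrite brE bracket_rep2; congr (_ + _).
rewrite db_atC linearN /= tmapr_swap (bilinNl b3); congr (- _).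
by rewrite -vhat_at_comm -/(double_vhat β α γ) -(double_vhat_rot β) rep3_rot.
Qed.

(** Rotating both tensors in the last two terms makes the decoration by M the same in all
three terms, so that they add up to a decorated tribracket. *)
Lemma double_term_cyclic a α b β c γ :
  double_term a α b β c γ + double_term b β c γ a α + double_term c γ a α b β = 0.
Proof.
rewrite /double_term -[in X in _ + X + _]rep3_rot -[in X in _ + _ + X]rep3_rot.
rewrite -[in X in _ + _ + X]rep3_rot !double_vhat_rot -!(bilinDl b3).
by rewrite double_db_cyclic (bilin0l b3).
Qed.

Lemma jacobiator_gen a α b β c γ :
  jacobiator br (rep_gen a α) (rep_gen b β) (rep_gen c γ) = 0.
Proof.
rewrite /jacobiator !bracket_bracket.
have cancel_cyclic (p q r p' q' r' : C) :
    p + q + r = 0 -> p' + r' + q' = 0 -> (p - p') + (q - q') + (r - r') = 0.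
  move=> pqr pqr'; rewrite (addrACA p) -opprD (addrACA (p + q)) -opprD pqr.
  by rewrite addrAC pqr' subr0.
by apply: cancel_cyclic; exact: double_term_cyclic.
Qed.
End Jacobi.
End Bracket.

Theorem theorem1p1 (K : comPzRingType) (A : nuAlgType K) (M : coalgType K)
    (db : {linear (A ⊗ A)%type -> (A ⊗ A)%type}) (v : {linear (M ⊗ M)%type -> K^o}) :
  double_poisson db -> cyclic_form v ->
  exists! br : rep_alg A M -> rep_alg A M -> rep_alg A M,
    poisson_bracket br /\
    forall (a b : A) (α β : M) (s : seq (A * A)) (t : seq (M * M)),
      db (a ⊗ b) = \sum_(p <- s) p.1 ⊗ p.2 ->
      vhat v (α ⊗ β) = \sum_(q <- t) q.1 ⊗ q.2 ->
      br (rep_gen a α) (rep_gen b β) =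
        \sum_(p <- s) \sum_(q <- t) rep_gen p.1 q.1 ∙ rep_gen p.2 q.2.
Proof.
move=> dbP vC.
have Bb := @gen_bracket_bilin K A M db v.
have BM := gen_bracket_coleibniz v dbP.
have BN := gen_bracketN dbP vC.
pose br := rep_bracket (gen_bracket db v).
have brE a α b β : br (rep_gen a α) (rep_gen b β) = gen_bracket db v a α b β.
  exact: rep_bracketE.
have brr x : derivation (br x) by exact: rep_bracket_derivationr.
have brl y : derivation (br^~ y) by exact: rep_bracket_derivationl.
have brN x y : br x y = - br y x by exact: rep_bracketN.
exists br; split.
  split; last first.
    by move=> a b α β s t sE tE; rewrite brE /gen_bracket /db_at /vhat_at /= sE tE rep2_sum.
  split=> //.
  - by split=> [y|x]; exact: der_linear.
  - by move=> x; exact: (der_leibniz (brr x)).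
  - by move=> x y z; rewrite (der_leibniz (brl z)) addrC.
  - by apply: jacobiator_eq0 => // a α b β c γ; exact: (jacobiator_gen dbP vC brr brE).
move=> br' [[br'b br'N br'Mr br'Ml _] br'E].
have br'r x : derivation (br' x) by split; [exact: br'b.2 | exact: br'Mr].
have br'l y : derivation (br'^~ y).
  by split=> [|x z]; [exact: br'b.1 | rewrite br'Ml addrC].
apply/funext => x; apply/funext => y; move: x.
apply: derivation_ext => // a α; move: y; apply: derivation_ext => // b β.
have [s sE] := tensor_expand (db (a ⊗ b)).
have [t tE] := tensor_expand (vhat v (α ⊗ β)).
by rewrite (br'E _ _ _ _ _ _ sE tE) brE /gen_bracket /db_at /vhat_at /= sE tE rep2_sum.
Qed.
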